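(* Consider the two-agent scalar LQ game with dynamics $x_{t+1}=ax_t+b^1u^1_t+b^2u^2_t$, $t\in\{0,\dots,t_f-1\}$, $b^1,b^2\neq 0$, and losses $J^1,J^2$ given in the context. (a) The game with the open-loop information structure (decision variables $\gamma^i_t=u^i_t$) is a potential game if and only if $$Q^1_1b^1b^2+(R^1_0)_{12}=Q^2_1b^1b^2+(R^2_0)_{12}\qquad( * )$$ and, for every $t\in\{1,\dots,t_f-1\}$, $Q^1_{t+1}=Q^2_{t+1}$ and $(R^1_t)_{12}=(R^2_t)_{12}$. (b) The game with the full-state feedback information structure (decision variables $\gamma^i_t=K^i_t$, $u^i_t=-K^i_tx_t$) is a potential game if and only if $( * )$ holds and, for every $t\in\{1,\dots,t_f-1\}$ and all $l,h\in\{1,2\}$, $Q^1_{t+1}=Q^2_{t+1}$ and $(R^1_t)_{lh}=(R^2_t)_{lh}$.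
   Context: The game has $N=2$ agents, horizon $t_f\geq 1$, scalar states $x_t\in\mathbb{R}$ and scalar actions $u^i_t\in\mathbb{R}$, $i\in\{1,2\}$, with random initial state $x_0\sim\mathcal{D}$, and $a,b^1,b^2\in\mathbb{R}$. The desired states are zero, and the real-valued loss of agent $i$ is $$J^i(\gamma)=\mathbb{E}_{x_0\sim\mathcal{D}}\Big[\sum_{t=0}^{t_f}Q^i_t(x_t)^2+\sum_{t=0}^{t_f-1}\big((R^i_t)_{11}(u^1_t)^2+2(R^i_t)_{12}u^1_tu^2_t+(R^i_t)_{22}(u^2_t)^2\big)\Big],$$ where $Q^i_t\ge 0$, $(R^i_t)_{12}=(R^i_t)_{21}\in\mathbb{R}$, $(R^i_t)_{ll}\geq 0$ for $l\neq i$ and $(R^i_t)_{ii}>0$. Decision variables: $\gamma^i=(\gamma^i_0,\dots,\gamma^i_{t_f-1})\in\mathbb{R}^{t_f}$ and $\gamma=(\gamma^1,\gamma^2)$. In the open-loop information structure $\gamma^i_t=u^i_t\in\mathbb{R}$. In the full-state feedback information structure $\gamma^i_t=K^i_t\in\mathbb{R}$ with $u^i_t=-K^i_tx_t$. Potential game: the game is potential if and only if there exists a real-valued function $\Pi$ of $\gamma$ such that for each agent $i$, every decision $\gamma^{-i}$ of the other agent, and all $\gamma^i,\hat\gamma^i\in\mathbb{R}^{t_f}$, $J^i(\gamma^i,\gamma^{-i})-J^i(\hat\gamma^i,\gamma^{-i})=\Pi(\gamma^i,\gamma^{-i})-\Pi(\hat\gamma^i,\gamma^{-i})$.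
   Formalization: The ''only if'' directions in (a) and (b) additionally assume a ≠ 0 or t_f = 1, and in (b) also that x_0 is not almost surely 0; without these they are false. The ''if'' directions are proved without these assumptions. *)

(* Defs.v *)
From HB Require Import structures.
From mathcomp Require Import all_boot all_order all_algebra.
From mathcomp Require Import all_classical all_reals all_analysis.

Set Implicit Arguments.
Unset Strict Implicit.
Unset Printing Implicit Defensive.

Import Order.TTheory GRing.Theory Num.Theory.

Local Open Scope ring_scope.

(* The two agents are the elements 0 and 1 of 'I_2; a decision gamma^i in
   R^tf is a row vector. *)
Definition profile (R : realType) (tf : nat) := 'I_2 -> 'rV[R]_tf.

Section potential.
Context {R : realType} {tf : nat}.

(* The profile (v, gamma^{-i}). *)
Definition deviate (g : profile R tf) (i : 'I_2) (v : 'rV[R]_tf) :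
    profile R tf :=
  fun j => if j == i then v else g j.

Definition potential_game (J : 'I_2 -> profile R tf -> R) : Prop :=
  exists Pi : profile R tf -> R,
    forall (i : 'I_2) (g : profile R tf) (v w : 'rV[R]_tf),
      J i (deviate g i v) - J i (deviate g i w) =
      Pi (deviate g i v) - Pi (deviate g i w).

(* The t-th entry of gamma^i.  The value 0 for t >= tf is never used: the
   trajectory up to time tf only involves the actions at times t < tf. *)
Definition decision (g : profile R tf) (i : 'I_2) (t : nat) : R :=
  oapp (g i 0) 0 (insub t : option 'I_tf).

(* An information structure turns a profile into actions: agent i at time t
   and in state x plays [info g i t x]. *)
Definition open_loop (g : profile R tf) (i : 'I_2) (t : nat) (x : R) : R :=
  decision g i t.

Definition feedback (g : profile R tf) (i : 'I_2) (t : nat) (x : R) : R :=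
  - decision g i t * x.

End potential.

Section lq_game.
Context {R : realType} (D : probability R R) (tf : nat).
Context (a : R) (b : 'I_2 -> R).
Context (Q : 'I_2 -> nat -> R) (Rm : 'I_2 -> nat -> 'M[R]_2).
Context (info : profile R tf -> 'I_2 -> nat -> R -> R).

Fixpoint state (g : profile R tf) (x0 : R) (t : nat) : R :=
  if t is s.+1 then
    let x := state g x0 s in a * x + b 0 * info g 0 s x + b 1 * info g 1 s x
  else x0.

Definition action (g : profile R tf) (x0 : R) (i : 'I_2) (t : nat) : R :=
  info g i t (state g x0 t).

Definition cost (i : 'I_2) (g : profile R tf) (x0 : R) : R :=
  \sum_(0 <= t < tf.+1) Q i t * state g x0 t ^+ 2 +
  \sum_(0 <= t < tf)
    (Rm i t 0 0 * action g x0 0 t ^+ 2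
     + 2 * Rm i t 0 1 * action g x0 0 t * action g x0 1 t
     + Rm i t 1 1 * action g x0 1 t ^+ 2).

Definition loss (i : 'I_2) (g : profile R tf) : R := fine 'E_D[cost i g].

(* [loss] is the expectation proper, and not a junk value of [fine]. *)
Definition real_valued_loss : Prop :=
  forall (i : 'I_2) (g : profile R tf),
    D.-integrable setT (EFin \o cost i g).

End lq_game.

(* Main.v *)
(* A two-agent game is potential iff the mixed differences of J^1 - J^2 vanish.
   Those mixed differences can be computed before taking the expectation.
   - Open loop: the state is affine in the inputs, so the mixed difference is a
     bilinear form in the inputs, free of x_0.  Inputs of the two agents whose
     responses are unit impulses at times T and T, or T and T+1, isolate its
     coefficients; for T and T+1 the coefficient comes multiplied by a.
   - Feedback: the cost is x_0^2 times a function of the gains, so E[x_0^2] <> 0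
     factors out.  Varying the gains at time 0 forces the cost to go from time 1
     to be constant.  By Bellman recursion the constant cost to go at time t is
     q + r(k, l) + (a - b^1 k - b^2 l)^2 w with w the cost to go at time t+1,
     and a <> 0 forces w = 0 and r = 0. *)
Require Import Defs.
From mathcomp Require Import all_boot all_order all_algebra.
From mathcomp Require Import all_classical all_reals all_analysis.
From mathcomp Require Import ring lra.

Set Implicit Arguments.
Unset Strict Implicit.
Unset Printing Implicit Defensive.

Import Order.TTheory GRing.Theory Num.Theory.

Local Open Scope ring_scope.

(** * Potential games and mixed differences *)

Section mixed_difference.
Context {R : realType} {tf : nat}.
Implicit Types (J F : profile R tf -> R) (u v : 'rV[R]_tf).

Definition pair_profile u v : profile R tf := fun j => if j == 0 then u else v.

Definition mixed F u u' v v' : R :=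
  (F (pair_profile u v) - F (pair_profile u' v))
  - (F (pair_profile u v') - F (pair_profile u' v')).

Lemma ord2_cases (i : 'I_2) : i = 0 \/ i = 1.
Proof. by case: i => [[|[|n]] //= Hi]; [left|right]; apply: val_inj. Qed.

Lemma pair_profileE (g : profile R tf) : g = pair_profile (g 0) (g 1).
Proof.
by apply/funext => j; rewrite /pair_profile; case: (ord2_cases j) => ->.
Qed.

Lemma deviate_pair0 u v w : deviate (pair_profile u v) 0 w = pair_profile w v.
Proof.
apply/funext => j; rewrite /deviate /pair_profile.
by case: (ord2_cases j) => ->.
Qed.

Lemma deviate_pair1 u v w : deviate (pair_profile u v) 1 w = pair_profile u w.
Proof.
apply/funext => j; rewrite /deviate /pair_profile.
by case: (ord2_cases j) => ->.
Qed.

(* The difference of the two losses separates: its part depending on one agent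
   only is what corrects the loss of the other agent into a potential. *)
Lemma potential_gameP (J : 'I_2 -> profile R tf -> R) :
  potential_game J <->
  forall u u' v v', mixed (fun g => J 0 g - J 1 g) u u' v v' = 0.
Proof.
rewrite /mixed; split=> [[Pi HPi] u u' v v'|H].
  have e0 w : J 0 (pair_profile u w) - J 0 (pair_profile u' w) =
      Pi (pair_profile u w) - Pi (pair_profile u' w).
    by have := HPi 0 (pair_profile u w) u u'; rewrite !deviate_pair0.
  have e1 w : J 1 (pair_profile w v) - J 1 (pair_profile w v') =
      Pi (pair_profile w v) - Pi (pair_profile w v').
    by have := HPi 1 (pair_profile w v) v v'; rewrite !deviate_pair1.
  by have := e0 v; have := e0 v'; have := e1 u; have := e1 u'; lra.
exists (fun g => J 0 g
  - (J 0 (pair_profile 0 (g 1)) - J 1 (pair_profile 0 (g 1)))).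
move=> i g v w; rewrite (pair_profileE g).
case: (ord2_cases i) => ->; rewrite ?deviate_pair0 ?deviate_pair1 /=.
  by rewrite /pair_profile /=; ring.
by have := H (g 0) 0 v w; rewrite /pair_profile /=; lra.
Qed.

Lemma decision_row (k l : nat -> R) t : (t < tf)%N ->
  decision (pair_profile (\row_i k i) (\row_i l i)) 0 t = k t /\
  decision (pair_profile (\row_i k i) (\row_i l i)) 1 t = l t.
Proof.
by move=> ht; rewrite /decision /pair_profile !insubT /=; split; rewrite mxE.
Qed.

Lemma decision_pair0 u v v' t :
  decision (pair_profile u v) 0 t = decision (pair_profile u v') 0 t.
Proof. by []. Qed.

Lemma decision_pair1 u u' v t :
  decision (pair_profile u v) 1 t = decision (pair_profile u' v) 1 t.
Proof. by []. Qed.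

End mixed_difference.

(** * Stagewise form of the cost and the game of weight differences *)

Section stage_cost.
Context {R : realType} (tf : nat) (a : R) (b : 'I_2 -> R).
Implicit Types (Q : 'I_2 -> nat -> R) (Rm : 'I_2 -> nat -> 'M[R]_2).
Implicit Type info : profile R tf -> 'I_2 -> nat -> R -> R.

Definition qform (M : 'M[R]_2) (x y : R) : R :=
  M 0 0 * x ^+ 2 + 2 * M 0 1 * x * y + M 1 1 * y ^+ 2.

(** Pairing the inputs at time [t] with the state they produce isolates the initial penalty, which
    no decision affects. *)
Lemma cost_stages Q Rm info i g x0 :
  cost a b Q Rm info i g x0 = Q i 0%N * x0 ^+ 2 +
    \sum_(0 <= t < tf) (Q i t.+1 * state a b info g x0 t.+1 ^+ 2 +
      qform (Rm i t) (action a b info g x0 0 t) (action a b info g x0 1 t)).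
Proof. by rewrite /cost big_nat_recl //= [in RHS]big_split /= addrA. Qed.

(** The agent index is ignored but kept: the cost is linear in its weights, so the difference of two
    costs is again a [cost]. *)
Definition gap (V : zmodType) (f : 'I_2 -> nat -> V) : 'I_2 -> nat -> V :=
  fun _ t => f 0 t - f 1 t.

Lemma costB Q Rm info g x0 :
  cost a b Q Rm info 0 g x0 - cost a b Q Rm info 1 g x0 =
  cost a b (gap Q) (gap Rm) info 0 g x0.
Proof.
rewrite !cost_stages /gap opprD addrACA -sumrB; congr (_ + _); first by ring.
by apply: eq_bigr => t _; rewrite /qform !mxE; ring.
Qed.

End stage_cost.

(** * Open-loop structure: the bilinear interaction of the inputs *)

Section open_loop_game.
Context {R : realType} (tf : nat) (a : R) (b : 'I_2 -> R).
Variables (Q : 'I_2 -> nat -> R) (Rm : 'I_2 -> nat -> 'M[R]_2).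

(** Zero-state response of the dynamics to the input [k] entering with coefficient [c]. *)
Fixpoint response (c : R) (k : nat -> R) (t : nat) : R :=
  if t is s.+1 then a * response c k s + c * k s else 0.

Lemma open_loop_state (g : profile R tf) x0 t :
  state a b (@open_loop R tf) g x0 t =
  a ^+ t * x0 + response (b 0) (decision g 0) t
              + response (b 1) (decision g 1) t.
Proof.
elim: t => [|t IH] /=; first by rewrite expr0; ring.
by rewrite IH exprS /open_loop; ring.
Qed.

(** Half of the part of the cost that is bilinear in the inputs of the two agents. *)
Definition cross (k l : nat -> R) : R :=
  \sum_(0 <= t < tf) (Q 0 t.+1 * response (b 0) k t.+1 * response (b 1) l t.+1
                      + Rm 0 t 0 1 * k t * l t).

Lemma responseB c k k' t :
  response c (fun s => k s - k' s) t = response c k t - response c k' t.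
Proof. by elim: t => [|t IH] /=; rewrite ?subr0 // IH; ring. Qed.

(** By superposition the cost is quadratic in the inputs and [x0]; a mixed difference keeps only
    products of one input of each agent. *)
Lemma open_loop_mixed u u' v v' x0 :
  mixed (fun g => cost a b Q Rm (@open_loop R tf) 0 g x0) u u' v v' =
  2 * cross (fun t => decision (pair_profile u v) 0 t
                      - decision (pair_profile u' v) 0 t)
            (fun t => decision (pair_profile u v) 1 t
                      - decision (pair_profile u v') 1 t).
Proof.
rewrite /mixed !cost_stages.
have cancel z A B C E : (z + A - (z + B)) - (z + C - (z + E)) =
  A - B - (C - E) :> R by ring.
rewrite cancel -!sumrB /cross mulr_sumr; apply: eq_bigr => t _.
rewrite /action /open_loop !open_loop_state !responseB /qform.
(* Profiles sharing a row share that decision; the equalities are between functions so that they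
   rewrite inside [response]. *)
have := decision_pair1 u u' v; have := decision_pair1 u u' v'.
have := decision_pair0 u v v'; have := decision_pair0 u' v v'.
move=> /funext -> /funext -> /funext -> /funext ->.
ring.
Qed.

Lemma response_ext c k k' t : (forall s, (s < t)%N -> k s = k' s) ->
  response c k t = response c k' t.
Proof.
by elim: t => [//|t IH] H /=; rewrite H // IH // => s /ltnW; exact: H.
Qed.

Lemma cross_ext k k' l l' :
  (forall s, (s < tf)%N -> k s = k' s /\ l s = l' s) ->
  cross k l = cross k' l'.
Proof.
move=> H; rewrite /cross !big_mkord; apply: eq_bigr => t _.
have [<- <-] := H t (ltn_ord t).
have ext s (hs : (s < t.+1)%N) := H s (leq_trans hs (ltn_ord t)).
rewrite (@response_ext _ k k') => [|s /ext[] //].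
by rewrite (@response_ext _ l l') => [|s /ext[] //].
Qed.

(** The input [1 / c] at time [T - 1] lifts the state to 1, and [- a / c] at time [T] brings it back
    to 0. *)
Definition impulse_input (c : R) (T t : nat) : R :=
  ((t.+1 == T)%:R - a * (t == T)%:R) / c.

Lemma response_impulse c T t : c != 0 -> (0 < T)%N ->
  response c (impulse_input c T) t = (t == T)%:R.
Proof.
move=> c0 T0; elim: t => [|t IH] /=; first by case: T T0.
by rewrite IH /impulse_input mulrCA divff // mulr1 addrC subrK.
Qed.

Lemma cross_impulse T T' : b 0 != 0 -> b 1 != 0 -> (0 < T)%N -> (0 < T')%N ->
  cross (impulse_input (b 0) T) (impulse_input (b 1) T') =
  \sum_(0 <= t < tf) (Q 0 t.+1 * (t.+1 == T)%:R * (t.+1 == T')%:R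
     + Rm 0 t 0 1 * impulse_input (b 0) T t * impulse_input (b 1) T' t).
Proof.
move=> b0 b1 T0 T'0; apply: eq_bigr => t _.
by rewrite !response_impulse.
Qed.

Lemma big_nat_pick (F : nat -> R) (s : nat) : (s < tf)%N ->
  (forall t, (t < tf)%N -> t != s -> F t = 0) -> \sum_(0 <= t < tf) F t = F s.
Proof.
move=> hs H; rewrite big_mkord (bigD1 (Ordinal hs)) //= big1 ?addr0 // => i.
by move=> hi; apply: H.
Qed.

Lemma cross_eq0_cond : b 0 != 0 -> b 1 != 0 -> tf = 1%N \/ a != 0 ->
  (0 < tf)%N -> (forall k l, cross k l = 0) ->
  Q 0 1%N * b 0 * b 1 + Rm 0 0%N 0 1 = 0 /\
  forall t, (1 <= t < tf)%N -> Q 0 t.+1 = 0 /\ Rm 0 t 0 1 = 0.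
Proof.
move=> b0 b1 ha htf H.
(* Impulses at [t] and [t.+1] never meet in the state; their inputs meet only at time [t], with
   product [- a / (b 0 * b 1)]. *)
have R0 t : (1 <= t < tf)%N -> Rm 0 t 0 1 = 0.
  move=> /andP[t1 lt]; case: ha => [e|a0].
    by move: t1 lt; rewrite e; case: t.
  have := H (impulse_input (b 0) t) (impulse_input (b 1) t.+1).
  rewrite cross_impulse // (big_nat_pick (s := t)) //.
    rewrite /impulse_input !eqxx (gtn_eqF (ltnSn t)) (ltn_eqF (ltnSn t)) /=.
    move/eqP; rewrite !(mulr0, mul0r, mulr1, mul1r, add0r, sub0r, subr0).
    rewrite !mulf_eq0 !invr_eq0 oppr_eq0 (negbTE a0) (negbTE b0) (negbTE b1).
    by rewrite !orbF => /eqP.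
  move=> s _ st; rewrite /impulse_input !eqSS (negbTE st).
  case: (s =P t.+1) => [->|/eqP ss].
    by rewrite (gtn_eqF (ltnW (ltnSn t.+1))) !(mulr0, mul0r, subr0, addr0).
  by rewrite !(mulr0, mul0r, subr0, addr0).
(* Two impulses at [t.+1] meet in the state at [t.+1] and in the inputs at [t], with product
   [1 / (b 0 * b 1)]. *)
have QR t : (t < tf)%N -> Q 0 t.+1 * b 0 * b 1 + Rm 0 t 0 1 = 0.
  move=> lt; have := H (impulse_input (b 0) t.+1) (impulse_input (b 1) t.+1).
  rewrite cross_impulse // (big_nat_pick (s := t)) //.
    rewrite /impulse_input !eqxx (ltn_eqF (ltnSn t)) /=.
    rewrite !(mulr0, mulr1, subr0) => h.
    have -> : Q 0 t.+1 * b 0 * b 1 + Rm 0 t 0 1 =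
      (Q 0 t.+1 + Rm 0 t 0 1 * (1 / b 0) * (1 / b 1)) * (b 0 * b 1).
      by field; rewrite b0 b1.
    by rewrite h mul0r.
  move=> s ls st; rewrite /impulse_input !eqSS (negbTE st).
  case: (s =P t.+1) => [es|_]; last by rewrite !(mulr0, mul0r, subr0, addr0).
  (* The inputs cancelling the two impulses also meet, at [t.+1], but there the cross weight is
     already known to vanish. *)
  have -> : Rm 0 s 0 1 = 0 by apply: R0; rewrite ls es.
  by rewrite !(mulr0, mul0r, addr0).
split; first exact: QR.
move=> t ht; have := R0 t ht; case/andP: ht => _ /QR; move=> + e.
rewrite e addr0 => /eqP.
by rewrite !mulf_eq0 (negbTE b0) (negbTE b1) !orbF => /eqP.
Qed.

Lemma cond_cross_eq0 :
  Q 0 1%N * b 0 * b 1 + Rm 0 0%N 0 1 = 0 ->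
  (forall t, (1 <= t < tf)%N -> Q 0 t.+1 = 0 /\ Rm 0 t 0 1 = 0) ->
  forall k l, cross k l = 0.
Proof.
move=> star H k l; rewrite /cross big_mkord big1 // => -[[|t] ht] _ /=.
  (* Responses start at 0, so at time 1 they are [b 0 * k 0] and [b 1 * l 0]. *)
  transitivity ((Q 0 1%N * b 0 * b 1 + Rm 0 0%N 0 1) * k 0%N * l 0%N).
    by ring.
  by rewrite star !mul0r.
by have [-> ->] := H t.+1 ht; rewrite !mul0r addr0.
Qed.

End open_loop_game.

(** * Feedback structure: Bellman recursion on the cost to go *)

Section feedback_game.
Context {R : realType} (a : R) (b : 'I_2 -> R).
Variables (q : nat -> R) (S : nat -> 'M[R]_2).

(* Cost to go from time [s] and state 1 when [n] stages remain. *)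
Fixpoint tail_cost (n s : nat) (k l : nat -> R) : R :=
  if n is m.+1 then
    q s + qform (S s) (k s) (l s)
    + (a - b 0 * k s - b 1 * l s) ^+ 2 * tail_cost m s.+1 k l
  else q s.

Lemma tail_cost_ext n s k k' l l' :
  (forall t, (s <= t < s + n)%N -> k t = k' t /\ l t = l' t) ->
  tail_cost n s k l = tail_cost n s k' l'.
Proof.
elim: n s => [//|n IH] s H /=.
have [|-> ->] := H s; first by rewrite leqnn addnS ltnS leq_addr.
rewrite (IH s.+1) // => t /andP[h1 h2]; apply: H.
by rewrite (ltnW h1) addnS -addSn.
Qed.

Lemma tail_cost_set n s k l x y :
  tail_cost n.+1 s (fun t => if t == s then x else k t)
                   (fun t => if t == s then y else l t) =
  q s + qform (S s) x y
  + (a - b 0 * x - b 1 * y) ^+ 2 * tail_cost n s.+1 k l.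
Proof.
rewrite /= eqxx; congr (_ + _ * _); apply: tail_cost_ext => t /andP[ht _].
by rewrite gtn_eqF.
Qed.

(** Under linear feedback every action and the next state are multiples of the current state, so the
    cost to go scales with its square. *)
Lemma feedback_cost_tail tf (g : profile R tf) x0 s n :
  let x := state a b (@feedback R tf) g x0 in
  q s * x s ^+ 2 + \sum_(s <= t < s + n) (q t.+1 * x t.+1 ^+ 2 +
    qform (S t) (feedback g 0 t (x t)) (feedback g 1 t (x t))) =
  x s ^+ 2 * tail_cost n s (decision g 0) (decision g 1).
Proof.
move=> x; elim: n s => [|n IH] s.
  by rewrite addn0 big_geq // addr0 mulrC.
rewrite big_ltn ?addnS ?ltnS ?leq_addr // -addSn.
have := IH s.+1; set X := \sum_(_ <= _ < _) _ => /= h.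
set w := tail_cost n _ _ _ in h *.
transitivity (q s * x s ^+ 2 +
  qform (S s) (feedback g 0 s (x s)) (feedback g 1 s (x s)) +
  (q s.+1 * x s.+1 ^+ 2 + X)); first by rewrite /x; ring.
rewrite h /x /= -/x /feedback /qform; ring.
Qed.

Lemma stage_const_eq0 (M : 'M[R]_2) (w c : R) : a != 0 -> b 0 != 0 ->
  M 1 0 = M 0 1 ->
  (forall x y, qform M x y + (a - b 0 * x - b 1 * y) ^+ 2 * w = c) ->
  w = 0 /\ M = 0.
Proof.
move=> a0 b0 sym H.
have w0 : w = 0.
  (* The form in [M] is even, so it cancels between [(1, 0)] and [(-1, 0)]; only the term of the
     square linear in [x] survives. *)
  have e : 4 * a * b 0 * w = 0.
    by have := H 1 0; have := H (-1) 0; rewrite /qform; lra.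
  apply/eqP; move/eqP: e.
  by rewrite !mulf_eq0 (negbTE a0) (negbTE b0) pnatr_eq0 /=.
split=> //; move: H; rewrite w0 /qform => H.
have H00 := H 0 0; have H10 := H 1 0; have H01 := H 0 1; have H11 := H 1 1.
apply/matrixP => i j; rewrite mxE.
by case: (ord2_cases i) => ->; case: (ord2_cases j) => ->; rewrite ?sym; lra.
Qed.

Lemma tail_cost_const n s c : n = 0%N \/ a != 0 -> b 0 != 0 ->
  (forall t, (s <= t < s + n)%N -> S t 1 0 = S t 0 1) ->
  (forall k l, tail_cost n s k l = c) ->
  q s = c /\ forall t, (s <= t < s + n)%N -> q t.+1 = 0 /\ S t = 0.
Proof.
move=> ha b0; elim: n s c ha => [|n IH] s c ha sym H.
  split=> [|t]; first exact: (H (fun=> 0) (fun=> 0)).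
  by rewrite addn0 ltnNge => /andP[->].
case: ha => [//|a0].
(* The gains [x], [y] at time [s] vary while the later ones stay fixed. The next tail is then
   constantly 0, which feeds the induction with [c] equal to 0. *)
have h k l : tail_cost n s.+1 k l = 0 /\ S s = 0.
  apply: (@stage_const_eq0 _ _ (c - q s)) => // [|x y].
    by apply: sym; rewrite leqnn addnS ltnS leq_addr.
  rewrite -(H (fun t => if t == s then x else k t)
              (fun t => if t == s then y else l t)) tail_cost_set; ring.
have [|| |qs IHs] := IH s.+1 0; first by right.
- by move=> t /andP[h1 h2]; apply: sym; rewrite (ltnW h1) addnS -addSn.
- by move=> k l; have [] := h k l.
have [w0 S0] := h (fun=> 0) (fun=> 0).
split=> [|t /andP[]].
  have := H (fun=> 0) (fun=> 0).
  by rewrite /= w0 S0 /qform !mxE; lra.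
rewrite leq_eqVlt => /orP[/eqP <- //|st] ht.
by apply: IHs; rewrite st addSn -addnS.
Qed.

Lemma cond_tail_cost n s k l :
  (forall t, (s <= t < s + n)%N -> q t.+1 = 0 /\ S t = 0) ->
  tail_cost n s k l = q s.
Proof.
elim: n s => [//|n IH] s H /=.
have [|q0 ->] := H s; first by rewrite leqnn addnS ltnS leq_addr.
rewrite IH ?q0 => [|t /andP[h1 h2]].
  by rewrite /qform !mxE !(mulr0, mul0r, addr0).
by apply: H; rewrite (ltnW h1) addnS -addSn.
Qed.

Definition tail_mixed n (k k' l l' : nat -> R) : R :=
  (tail_cost n 0 k l - tail_cost n 0 k' l)
  - (tail_cost n 0 k l' - tail_cost n 0 k' l').

(* If the first-stage closed-loop factor of one agent can be changed, the
   continuation cost cannot depend on the later gains of the other one. *)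
Lemma tail_mixed_const n : b 0 != 0 -> b 1 != 0 ->
  (forall k k' l l', tail_mixed n.+1 k k' l l' = 0) ->
  forall k l k' l', tail_cost n 1 k l = tail_cost n 1 k' l'.
Proof.
move=> b0 b1 H.
pose upd x (k : nat -> R) t := if t == 0%N then x else k t.
(* With one first gain 0, the other agent's gains [a / b 1] and [(a - 1) / b 1] give closed-loop
   factors 0 and 1, so just one of the two differences of tails survives. *)
have step1 k k' l : tail_cost n 1 k l = tail_cost n 1 k' l.
  have := H (upd 0 k) (upd 0 k') (upd (a / b 1) l) (upd ((a - 1) / b 1) l).
  rewrite /tail_mixed !tail_cost_set !mulr0 ![b 1 * (_ / _)]mulrCA divff //.
  by rewrite /qform; lra.
have step2 k l l' : tail_cost n 1 k l = tail_cost n 1 k l'.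
  have := H (upd (a / b 0) k) (upd ((a - 1) / b 0) k) (upd 0 l) (upd 0 l').
  rewrite /tail_mixed !tail_cost_set !mulr0 ![b 0 * (_ / _)]mulrCA divff //.
  by rewrite /qform; lra.
by move=> k l k' l'; rewrite (step1 k k') (step2 k' l l').
Qed.

Lemma tail_mixed_eq0_cond n : b 0 != 0 -> b 1 != 0 -> n = 0%N \/ a != 0 ->
  (forall t, (1 <= t < n.+1)%N -> S t 1 0 = S t 0 1) ->
  (forall k k' l l', tail_mixed n.+1 k k' l l' = 0) ->
  q 1%N * b 0 * b 1 + S 0%N 0 1 = 0 /\
  forall t, (1 <= t < n.+1)%N -> q t.+1 = 0 /\ S t = 0.
Proof.
move=> b0 b1 ha sym H; have W := tail_mixed_const b0 b1 H.
have [//| | q1 ?] :=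
    @tail_cost_const n 1 (tail_cost n 1 (fun=> 0) (fun=> 0)) ha b0.
  by move=> k l; exact: W.
split=> //.
pose upd x t : R := if t == 0%N then x else 0.
(* With the tail from time 1 constantly [q 1], first gains 0 and 1 produce twice the coefficient of
   [x * y] in stage 0. *)
have := H (upd 1) (upd 0) (upd 1) (upd 0).
by rewrite /tail_mixed !tail_cost_set -q1 /qform; lra.
Qed.

Lemma cond_tail_mixed_eq0 n :
  q 1%N * b 0 * b 1 + S 0%N 0 1 = 0 ->
  (forall t, (1 <= t < n.+1)%N -> q t.+1 = 0 /\ S t = 0) ->
  forall k k' l l', tail_mixed n.+1 k k' l l' = 0.
Proof.
move=> star H k k' l l'; rewrite /tail_mixed /= !cond_tail_cost // /qform.
transitivity (2 * (q 1%N * b 0 * b 1 + S 0%N 0 1)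
  * (k 0%N - k' 0%N) * (l 0%N - l' 0%N)); first by ring.
by rewrite star mulr0 !mul0r.
Qed.

End feedback_game.

(** * Mixed differences under the expectation *)

Section expected_mixed.
Context {R : realType} (D : probability R R) (tf : nat).
Variables (a : R) (b : 'I_2 -> R).
Variables (Q : 'I_2 -> nat -> R) (Rm : 'I_2 -> nat -> 'M[R]_2).
Variable info : profile R tf -> 'I_2 -> nat -> R -> R.
Hypothesis J_real : real_valued_loss D a b Q Rm info.

Let dcost (x : R) (g : profile R tf) := cost a b (gap Q) (gap Rm) info 0 g x.

Let dcost_integrable g : D.-integrable setT (EFin \o dcost^~ g).
Proof.
have := integrableB measurableT (J_real 0 g) (J_real 1 g).
by apply: eq_integrable => // x _; rewrite /= /dcost -costB.
Qed.

Let dcost_integrableB g g' :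
  D.-integrable setT (EFin \o (fun x => dcost x g - dcost x g')).
Proof.
exact: (integrableB measurableT (dcost_integrable _) (dcost_integrable _)).
Qed.

Lemma mixed_integrable u u' v v' :
  D.-integrable setT (EFin \o (fun x => mixed (dcost x) u u' v v')).
Proof.
exact: (integrableB measurableT (dcost_integrableB _ _) (dcost_integrableB _ _)).
Qed.

(** Integrability of the costs makes the expectation linear, so the mixed difference may be taken
    pointwise in the initial state. *)
Lemma loss_potentialP :
  potential_game (loss D a b Q Rm info) <->
  forall u u' v v', (\int[D]_x mixed (dcost x) u u' v v')%R = 0.
Proof.
have lossB g : loss D a b Q Rm info 0 g - loss D a b Q Rm info 1 g
    = (\int[D]_x dcost x g)%R.
  rewrite /loss unlock -RintegralB //.
  by apply: eq_Rintegral => x _; rewrite costB.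
have mixedE u u' v v' :
    mixed (fun g => loss D a b Q Rm info 0 g - loss D a b Q Rm info 1 g)
      u u' v v' = (\int[D]_x mixed (dcost x) u u' v v')%R.
  by rewrite /mixed !lossB -RintegralB // -RintegralB // -RintegralB.
by split=> [/potential_gameP H|H]; [|apply/potential_gameP] => u u' v v';
  rewrite -?mixedE // mixedE.
Qed.

End expected_mixed.

(** A nonnegative function with zero integral vanishes almost everywhere; for [x ^+ 2] this puts all
    the mass at 0. *)
Lemma second_moment_eq0 (R : realType) (D : probability R R) (d : R) :
  d != 0 -> D.-integrable setT (EFin \o (fun x : R => d * x ^+ 2)) ->
  (\int[D]_x (d * x ^+ 2))%R = 0 -> D [set 0]%classic = 1%E.
Proof.
move=> d0 di I0.
have si : D.-integrable setT (EFin \o (fun x : R => x ^+ 2)).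
  have := integrableZl measurableT d^-1 di.
  by apply: eq_integrable => // x _ /=; rewrite -EFinM mulKf.
have e0 : (\int[D]_x `|(x ^+ 2)%:E|)%E = 0%E.
  move: I0; rewrite RintegralZl // => /eqP; rewrite mulf_eq0 (negbTE d0) /=.
  move=> /eqP h.
  rewrite (eq_integral (fun x : R => (x ^+ 2)%:E)) => [|x _]; last first.
    by rewrite /= ger0_norm // sqr_ge0.
  by rewrite -[LHS]fineK ?integrable_fin_num //; congr EFin.
have neg : D.-negligible (~` [set 0])%classic.
  have [+ _] := ae_eq_integral_abs D measurableT (measurable_int D si).
  move=> /(_ e0); apply: negligibleS => x /= x0 /(_ Logic.I)[] /eqP.
  by rewrite expf_eq0 => /eqP.
have := probability_setC D (measurable_set1 0).
rewrite (measure_negligible (measurableC (measurable_set1 0)) neg).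
rewrite -[D _]fineK ?fin_num_measure // -EFinB => -[] /esym/eqP.
by rewrite subr_eq0 => /eqP <-.
Qed.

(** * The potential property under each information structure *)

Lemma open_loop_potentialP (R : realType) (D : probability R R) tf a b Q Rm :
  real_valued_loss D a b Q Rm (@open_loop R tf) ->
  potential_game (loss D a b Q Rm (@open_loop R tf)) <->
  forall k l, cross tf a b (gap Q) (gap Rm) k l = 0.
Proof.
move=> hJ; split=> [/(loss_potentialP hJ) H k l|H]; last first.
  apply/(loss_potentialP hJ) => u u' v v'.
  under eq_Rintegral do rewrite open_loop_mixed H mulr0.
  by rewrite Rintegral_cst // mul0r.
(* Against zero decisions the increments are [k] and [l] themselves up to the horizon, and the
   integrand is constant in the initial state. *)
have := H (\row_i k i) 0 (\row_i l i) 0.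
under eq_Rintegral do rewrite open_loop_mixed.
rewrite Rintegral_cst // [X in fine X](probability_setT D) mulr1 => /eqP.
rewrite mulf_eq0 pnatr_eq0 /= => /eqP e; rewrite -[RHS]e.
apply: cross_ext => s hs; have [-> ->] := decision_row k l hs.
by rewrite /decision /pair_profile insubT /= !mxE !subr0.
Qed.

Lemma feedback_mixed (R : realType) tf a b Q Rm u u' v v' (x0 : R) :
  mixed (fun g => cost a b Q Rm (@feedback R tf) 0 g x0) u u' v v' =
  tail_mixed a b (Q 0) (Rm 0) tf
    (decision (pair_profile u v) 0) (decision (pair_profile u' v) 0)
    (decision (pair_profile u v) 1) (decision (pair_profile u v') 1) * x0 ^+ 2.
Proof.
have E g : cost a b Q Rm (@feedback R tf) 0 g x0 =
    x0 ^+ 2 * tail_cost a b (Q 0) (Rm 0) tf 0 (decision g 0) (decision g 1).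
  by rewrite cost_stages (feedback_cost_tail a b (Q 0) (Rm 0) g x0 0 tf).
by rewrite /mixed !E /tail_mixed /decision /pair_profile /=; ring.
Qed.

Lemma feedback_potential (R : realType) (D : probability R R) tf a b Q Rm :
  real_valued_loss D a b Q Rm (@feedback R tf) ->
  (forall k k' l l', tail_mixed a b (gap Q 0) (gap Rm 0) tf k k' l l' = 0) ->
  potential_game (loss D a b Q Rm (@feedback R tf)).
Proof.
move=> hJ H; apply/(loss_potentialP hJ) => u u' v v'.
under eq_Rintegral do rewrite feedback_mixed H mul0r.
by rewrite Rintegral_cst // mul0r.
Qed.

(** The expected mixed difference is the integral of [d * x ^+ 2] with [d] free of the initial
    state, so [d] must vanish unless the initial state is 0 almost surely. *)
Lemma potential_feedback (R : realType) (D : probability R R) tf a b Q Rm :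
  real_valued_loss D a b Q Rm (@feedback R tf) -> D [set 0]%classic != 1%E ->
  potential_game (loss D a b Q Rm (@feedback R tf)) ->
  forall k k' l l', tail_mixed a b (gap Q 0) (gap Rm 0) tf k k' l l' = 0.
Proof.
move=> hJ D0 /(loss_potentialP hJ) H k k' l l'.
pose row (f : nat -> R) : 'rV[R]_tf := \row_i f i.
have := mixed_integrable hJ (row k) (row k') (row l) (row l').
have := H (row k) (row k') (row l) (row l').
under eq_Rintegral do rewrite feedback_mixed.
under [X in integrable _ _ X]eq_fun do rewrite /= feedback_mixed.
set d := tail_mixed _ _ _ _ _ _ _ _ _ => I0 di.
have <- : d = tail_mixed a b (gap Q 0) (gap Rm 0) tf k k' l l'.
  have E f f' g g' : tail_cost a b (gap Q 0) (gap Rm 0) tf 0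
      (decision (pair_profile (row f) (row f')) 0)
      (decision (pair_profile (row g) (row g')) 1) =
      tail_cost a b (gap Q 0) (gap Rm 0) tf 0 f g'.
    apply: tail_cost_ext => t; rewrite add0n => /andP[_ ht].
    by have [-> _] := decision_row f f' ht; have [_ ->] := decision_row g g' ht.
  by rewrite /d /tail_mixed !E.
apply: contraNeq D0 => d0.
by rewrite (second_moment_eq0 d0 di I0).
Qed.

(** Necessity excludes two degenerate cases. If [a] is 0, each open-loop stage only sees the sum
    [Q 0 t.+1 * b 0 * b 1 + Rm 0 t 0 1] of the difference game; if the initial state is 0 almost
    surely, all feedback losses are 0. *)
Theorem proposition5 (R : realType) (D : probability R R) (tf : nat)
    (a : R) (b : 'I_2 -> R)
    (Q : 'I_2 -> nat -> R) (Rm : 'I_2 -> nat -> 'M[R]_2) :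
  (1 <= tf)%N ->
  b 0 != 0 -> b 1 != 0 ->
  (forall i t, (t <= tf)%N -> 0 <= Q i t) ->
  (forall i t, (t < tf)%N -> Rm i t 0 1 = Rm i t 1 0) ->
  (forall i l t, (t < tf)%N -> l != i -> 0 <= Rm i t l l) ->
  (forall i t, (t < tf)%N -> 0 < Rm i t i i) ->
  let star :=
    Q 0 1%N * b 0 * b 1 + Rm 0 0%N 0 1 = Q 1 1%N * b 0 * b 1 + Rm 1 0%N 0 1 in
  let condition_a :=
    star /\
    forall t, (1 <= t < tf)%N ->
      Q 0 t.+1 = Q 1 t.+1 /\ Rm 0 t 0 1 = Rm 1 t 0 1 in
  let condition_b :=
    star /\
    forall t (l h : 'I_2), (1 <= t < tf)%N ->
      Q 0 t.+1 = Q 1 t.+1 /\ Rm 0 t l h = Rm 1 t l h in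
  let J_a := loss D a b Q Rm (@open_loop R tf) in
  let J_b := loss D a b Q Rm (@feedback R tf) in
  (real_valued_loss D a b Q Rm (@open_loop R tf) ->
     (tf = 1%N \/ a != 0 -> (potential_game J_a <-> condition_a)) /\
     (condition_a -> potential_game J_a)) /\
  (real_valued_loss D a b Q Rm (@feedback R tf) ->
     (tf = 1%N \/ a != 0 -> D [set 0]%classic != 1%E ->
        (potential_game J_b <-> condition_b)) /\
     (condition_b -> potential_game J_b)).
Proof.
case: tf => [//|n] _ b0 b1 _ sym _ _ star condition_a condition_b J_a J_b.
have starE : star <->
    gap Q 0 1%N * b 0 * b 1 + gap Rm 0 0%N 0 1 = 0.
  by rewrite /star /gap !mxE; split=> e; lra.
have condaE : condition_a <->
    gap Q 0 1%N * b 0 * b 1 + gap Rm 0 0%N 0 1 = 0 /\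
    forall t, (1 <= t < n.+1)%N -> gap Q 0 t.+1 = 0 /\ gap Rm 0 t 0 1 = 0.
  split=> -[/starE st H]; split=> // t /H[]; rewrite /gap !mxE.
    by move=> -> ->; rewrite !subrr.
  by move=> /subr0_eq -> /subr0_eq ->.
have condbE : condition_b <->
    gap Q 0 1%N * b 0 * b 1 + gap Rm 0 0%N 0 1 = 0 /\
    forall t, (1 <= t < n.+1)%N -> gap Q 0 t.+1 = 0 /\ gap Rm 0 t = 0.
  split=> -[/starE st H]; split=> // t.
    move=> ht; split; first by rewrite /gap (H t 0 0 ht).1 subrr.
    by apply/matrixP => i j; rewrite !mxE (H t i j ht).2 subrr.
  by move=> l h /H[/subr0_eq -> /subr0_eq ->].
split=> hJ; split.
- move=> ha; rewrite condaE; apply: (iff_trans (open_loop_potentialP hJ)).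
  split=> [|[st H]]; [exact: cross_eq0_cond|exact: cond_cross_eq0].
- move=> /condaE[st H]; apply/(open_loop_potentialP hJ).
  exact: cond_cross_eq0.
- move=> ha D0; split=> [/(potential_feedback hJ D0) H|/condbE[st H]].
    apply/condbE; apply: tail_mixed_eq0_cond H => //.
      by case: ha => [[->]|]; [left|right].
    by move=> t /andP[_ ht]; rewrite !mxE !sym.
  exact/(feedback_potential hJ)/cond_tail_mixed_eq0.
- move=> /condbE[st H].
  exact/(feedback_potential hJ)/cond_tail_mixed_eq0.
Qed.
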